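(* Let $n\geq 3$ and let $B_1\subset\mathbf{R}^n$ be the open unit ball centered at the origin. There exist families of functions $c_\epsilon\in L^{\frac n2}(B_1)$ and $u_\epsilon\in H^1(B_1)\cap C(\bar B_1)$, indexed by $\epsilon>0$, such that for each $\epsilon$ $$-\Delta u_\epsilon(x)+c_\epsilon(x)u_\epsilon(x)=0\quad\text{in } B_1$$ (in the weak sense), and (i) $u_\epsilon(x)\geq 1$ on $\partial B_1$; (ii) $u_\epsilon(0)=0$; (iii) $\lim_{\epsilon\to0^+}\|c_\epsilon\|_{L^{\frac n2}(B_1)}=0$.
   Context: The equation $-\Delta u+cu=0$ in $B_1$ holds in the weak sense if $\int_{B_1}\nabla u\cdot\nabla\varphi\,dx+\int_{B_1}c\,u\,\varphi\,dx=0$ for all $\varphi\in C_0^\infty(B_1)$. *)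

(* Defs.v *)
From HB Require Import structures.
From mathcomp Require Import all_boot all_order all_algebra.
From mathcomp Require Import all_classical all_reals all_analysis.

Set Implicit Arguments.
Unset Strict Implicit.
Unset Printing Implicit Defensive.
Import Order.TTheory GRing.Theory Num.Theory.
Import numFieldNormedType.Exports.

Local Open Scope classical_set_scope.
Local Open Scope ring_scope.

Section measurable_rV.
Context (R : realType) (n : nat).

Let coord (i : 'I_n) (x : 'rV[R]_n) : measurableTypeR R := x ord0 i.

Let rV_set0 : g_sigma_preimage coord set0.
Proof. exact: sigma_algebra0. Qed.

Let rV_setC A : g_sigma_preimage coord A -> g_sigma_preimage coord (~` A).
Proof. exact: sigma_algebraC. Qed.

Let rV_bigcup (F : (set 'rV[R]_n)^nat) :
  (forall i, g_sigma_preimage coord (F i)) ->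
  g_sigma_preimage coord (\bigcup_i (F i)).
Proof. exact: sigma_algebra_bigcup. Qed.

(* The product sigma-algebra on R^n, as for n.-tuple; it coincides with the
   Borel sigma-algebra of the topology of 'rV[R]_n. *)
HB.instance Definition _ := @isMeasurable.Build
  (measure_tuple_display default_measure_display) 'rV[R]_n
  (g_sigma_preimage coord) rV_set0 rV_setC rV_bigcup.

Lemma measurable_coord (i : 'I_n) :
  measurable_fun setT (fun x : 'rV[R]_n => x ord0 i : measurableTypeR R).
Proof.
move=> _ Y mY; rewrite setTI; apply: sub_sigma_algebra => /=.
rewrite -bigcup_seq/=; exists i => /=; first by rewrite mem_index_enum.
by exists Y => //; rewrite setTI.
Qed.

Lemma measurable_fun_rVP d (T : measurableType d) (f : T -> 'rV[R]_n) :
  (forall i, measurable_fun setT (fun x => f x ord0 i : measurableTypeR R)) ->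
  measurable_fun setT f.
Proof.
move=> mf; suff: g_sigma_preimage (fun i => coord i \o f) `<=` measurable.
  rewrite g_sigma_preimage_comp => prefS _ A mA; apply: prefS.
  by exists A.
apply: smallest_sub; first exact: sigma_algebra_measurable.
rewrite -bigcup_seq; apply: bigcup_sub => i _ A [B mB <-].
exact: mf.
Qed.

End measurable_rV.

Section lebesgue_rV_succ.
Context (R : realType) (n : nat).
Variable mu : {sigma_finite_measure set 'rV[R]_n -> \bar R}.

Definition cons_rV (x : measurableTypeR R * 'rV[R]_n) : 'rV[R]_n.+1 :=
  \row_i oapp (x.2 ord0) x.1 (unlift ord0 i).

Definition uncons_rV (x : 'rV[R]_n.+1) : measurableTypeR R * 'rV[R]_n :=
  (x ord0 ord0, \row_i x ord0 (lift ord0 i)).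

Lemma cons_rVK : cancel cons_rV uncons_rV.
Proof.
case=> a y; rewrite /uncons_rV /cons_rV mxE unlift_none /=; congr pair.
by apply/rowP => i; rewrite !mxE liftK.
Qed.

Lemma uncons_rVK : cancel uncons_rV cons_rV.
Proof.
move=> x; apply/rowP => i; rewrite mxE.
by case: unliftP => [j|] -> //=; rewrite mxE.
Qed.

Lemma measurable_cons_rV : measurable_fun setT cons_rV.
Proof.
apply: measurable_fun_rVP => i.
under eq_fun do rewrite mxE.
case: unliftP => [j|] _ /=; last exact: measurable_fst.
exact: (measurableT_comp (measurable_coord j) measurable_snd).
Qed.

Lemma measurable_uncons_rV : measurable_fun setT uncons_rV.
Proof.
apply/measurable_fun_pairP; split; first exact: measurable_coord.
apply: measurable_fun_rVP => i /=.
under eq_fun do rewrite mxE.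
exact: measurable_coord.
Qed.

Definition lebesgue_rV_succ : set 'rV[R]_n.+1 -> \bar R :=
  pushforward (lebesgue_measure \x mu)%E cons_rV.

Let lebesgue_rV_succ0 : lebesgue_rV_succ set0 = 0%E.
Proof. by have mf := measurable_cons_rV; exact: measure0. Qed.

Let lebesgue_rV_succ_ge0 A : (0 <= lebesgue_rV_succ A)%E.
Proof. by have mf := measurable_cons_rV; exact: measure_ge0. Qed.

Let lebesgue_rV_succ_sigma_additive : semi_sigma_additive lebesgue_rV_succ.
Proof.
by have mf := measurable_cons_rV; exact: measure_semi_sigma_additive.
Qed.

HB.instance Definition _ := isMeasure.Build _ _ _ lebesgue_rV_succ
  lebesgue_rV_succ0 lebesgue_rV_succ_ge0 lebesgue_rV_succ_sigma_additive.

Let lebesgue_rV_succ_sigma_finite : sigma_finite setT lebesgue_rV_succ.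
Proof.
have /sigma_finiteP[F [TF ndF Foo]] := sigma_finiteT (@lebesgue_measure R).
have /sigma_finiteP[G [TG ndG Goo]] := sigma_finiteT mu.
exists (fun k => uncons_rV @^-1` (F k `*` G k)) => [|k].
  rewrite -preimage_bigcup (_ : \bigcup_k _ = setT) ?preimage_setT//.
  apply/seteqP; split => // -[a x] _.
  have [k _ Fka] : (\bigcup_k F k) a by rewrite -TF.
  have [l _ Glx] : (\bigcup_k G k) x by rewrite -TG.
  exists (maxn k l) => //; split => /=.
  - by move: a Fka; exact/subsetPset/ndF/leq_maxl.
  - by move: x Glx; exact/subsetPset/ndG/leq_maxr.
have [mF Fk] := Foo k; have [mG Gk] := Goo k; split.
  rewrite -[X in measurable X]setTI.
  by apply: measurable_uncons_rV => //; exact: measurableX.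
rewrite /lebesgue_rV_succ /pushforward -comp_preimage.
rewrite (_ : uncons_rV \o cons_rV = id); last exact/funext/cons_rVK.
by rewrite preimage_id product_measure1E// lte_mul_pinfty// ge0_fin_numE.
Qed.

HB.instance Definition _ := Measure_isSigmaFinite.Build _ _ _
  lebesgue_rV_succ lebesgue_rV_succ_sigma_finite.

End lebesgue_rV_succ.

Fixpoint lebesgue_rV (R : realType) (n : nat) :
    {sigma_finite_measure set 'rV[R]_n -> \bar R} :=
  match n with
  | 0 => \d_(0 : 'rV[R]_0)
  | n'.+1 => lebesgue_rV_succ (lebesgue_rV R n')
  end.

Lemma lebesgue_rV_box (R : realType) (n : nat) (A : 'I_n -> set R) :
  (forall i, measurable (A i : set (measurableTypeR R))) ->
  lebesgue_rV R n [set x | forall i, A i (x ord0 i)] =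
  (\prod_(i < n) lebesgue_measure (A i))%E.
Proof.
elim: n A => [|n IHn] A mA.
  rewrite big_ord0 /= diracE mem_set //.
  by case.
rewrite big_ord_recl -IHn//.
have mB : measurable [set x : 'rV[R]_n | forall i, A (lift ord0 i) (x ord0 i)].
  rewrite (_ : mkset _ = \bigcap_(i in [set: 'I_n])
     ((fun x : 'rV[R]_n => x ord0 i : measurableTypeR R) @^-1` A (lift ord0 i))).
    apply: fin_bigcap_measurable => // i _.
    by rewrite -[X in measurable X]setTI; exact: measurable_coord.
  by apply/seteqP; split => x /= xA i; [move=> _|]; exact: xA.
rewrite -product_measure1E//.
congr ((lebesgue_measure \x lebesgue_rV R n)%E _).
apply/seteqP; split => -[a x] /=.
  move=> xA; split => [|i].
    by have := xA ord0; rewrite mxE unlift_none.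
  by have := xA (lift ord0 i); rewrite mxE liftK.
by move=> [aA xA] i; rewrite mxE; case: unliftP => [j|] ->.
Qed.

Section sobolev.
Context (R : realType) (n : nat).
Implicit Types (Omega : set 'rV[R]_n) (f u c phi : 'rV[R]_n -> R).

Local Notation leb := (lebesgue_rV R n).

(* The library norm on 'rV[R]_n is the sup norm, so the Euclidean one is
   spelled out. *)
Definition enorm (x : 'rV[R]_n) : R := Num.sqrt (\sum_(i < n) x ord0 i ^+ 2).

Definition unit_ball : set 'rV[R]_n := [set x | enorm x < 1].

Definition boundary Omega : set 'rV[R]_n := closure Omega `\` Omega°.

Definition partial (i : 'I_n) f : 'rV[R]_n -> R := fun x =>
  'D_(delta_mx ord0 i) f x.

Definition smooth f := forall s : seq 'I_n,
  continuous (foldr partial f s) /\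
  forall i x, derivable (foldr partial f s) x (delta_mx ord0 i).

Definition tsupport f : set 'rV[R]_n := closure [set x | f x != 0].

(* Elements of C_0^oo(Omega) are represented by their extension by zero. *)
Definition test_function Omega phi :=
  [/\ smooth phi, compact (tsupport phi) & tsupport phi `<=` Omega].

(* Functions on Omega are represented by total functions, whose values outside
   Omega are irrelevant: f \_ Omega is f on Omega and 0 elsewhere. *)
Definition Lp_norm Omega (p : R) f : \bar R := 'N[leb]_p%:E[EFin \o (f \_ Omega)].

Definition in_Lp Omega (p : R) f := f \_ Omega \in Lfun leb p%:E.

Definition weak_gradient Omega u (g : 'I_n -> 'rV[R]_n -> R) :=
  forall i phi, test_function Omega phi ->
    \int[leb]_(x in Omega) (u x * partial i phi x) =
    - \int[leb]_(x in Omega) (g i x * phi x).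

Definition L2_weak_gradient Omega u (g : 'I_n -> 'rV[R]_n -> R) :=
  (forall i, in_Lp Omega 2 (g i)) /\ weak_gradient Omega u g.

Definition in_H1 Omega u :=
  in_Lp Omega 2 u /\ exists g, L2_weak_gradient Omega u g.

(* - Delta u + c u = 0 in Omega, for u in H^1(Omega); the weak gradient g of u is
   unique up to a null set, so the choice of g is immaterial. Rintegral is 0 by
   convention on divergent integrals, but for c in L^p(Omega), p >= 1, Omega
   bounded and u also bounded, both integrands below are integrable. *)
Definition weak_solution Omega c u := exists2 g, L2_weak_gradient Omega u g &
  forall phi, test_function Omega phi ->
    \int[leb]_(x in Omega) (\sum_(i < n) g i x * partial i phi x) +
    \int[leb]_(x in Omega) (c x * u x * phi x) = 0.

End sobolev.

Arguments unit_ball : clear implicits.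

(* Main.v *)
(** The solution is radial: with s = |x|^2 and L = 1 - ln |x|, take
    u = L^(-eps) = exp (- eps ln L).  Since L tends to infinity at the origin,
    u extends by 0 there, and u = 1 on the unit sphere.  A computation gives
    Delta u = c u off the origin with
      c = eps ((n - 2) / (s L) + (1 + eps) / (s L^2)),
    so that 0 <= c <= eps (n - 1 + eps) / (s L).  The n/2-th power of 1 / (s L)
    is |x|^(-n) L^(-n/2), which is integrable because n/2 > 1; we see this on
    the shells e^(-k-1) < |x| <= e^(-k).  Hence c is O(eps) in L^(n/2).

    The origin is invisible to the weak formulation: u, its gradient and its
    second derivatives are O(|x|^(-2)), hence integrable as n >= 3, and almost
    every line parallel to an axis avoids the origin, so that Fubini's theorem
    and integration by parts on these lines suffice. *)
From HB Require Import structures.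
Require Import Defs.
From mathcomp Require Import all_boot all_order all_algebra.
From mathcomp Require Import all_classical all_reals all_analysis measurable_realfun.
From mathcomp Require Import ring lra.
Import Order.TTheory GRing.Theory Num.Theory.
Import numFieldNormedType.Exports.
Local Open Scope classical_set_scope.
Local Open Scope ring_scope.

Set Implicit Arguments.
Unset Strict Implicit.
Unset Printing Implicit Defensive.

(** * Open sets, continuous functions and boxes in the product sigma-algebra of R^n *)

Section rV_measurability.
Context {R : realType}.

Definition box_rV n (A : 'I_n -> set R) : set 'rV[R]_n :=
  [set x | forall i, A i (x ord0 i)].

Lemma measurable_box_rV n (A : 'I_n -> set R) :
  (forall i, measurable (A i : set (measurableTypeR R))) ->
  measurable (box_rV A).
Proof.
move=> mA; rewrite (_ : box_rV A = \bigcap_(i in [set: 'I_n])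
   ((fun x : 'rV[R]_n => x ord0 i : measurableTypeR R) @^-1` A i)).
  apply: fin_bigcap_measurable => // i _.
  by rewrite -[X in measurable X]setTI; exact: measurable_coord.
by apply/seteqP; split => x /= xA i; [move=> _|]; exact: xA.
Qed.

(** An open set is a countable union of open cubes with rational centre and radius 1 / (k + 1). *)
Lemma open_measurable_rV n (U : set 'rV[R]_n) : open U -> measurable U.
Proof.
move=> oU.
pose B (p : 'rV[rat]_n * nat) : set 'rV[R]_n :=
  box_rV (fun i => `](ratr (p.1 ord0 i) - p.2.+1%:R^-1),
                     (ratr (p.1 ord0 i) + p.2.+1%:R^-1)[%classic).
(* Cubes not contained in [U] are replaced by [set0], so that the union runs over a whole countable
   type. *)
pose F p := if asbool (B p `<=` U) then B p else set0.
rewrite (_ : U = \bigcup_p F p).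
  apply: countable_bigcupT_measurable => // p.
  rewrite /F; case: ifP => // _.
  by apply: measurable_box_rV => i; exact: measurable_itv.
apply/seteqP; split=> [x Ux|x [p _]]; last first.
  by rewrite /F; case: asboolP => // + Bx; exact.
have /nbhs_ballP[e /= e0 xeU] : nbhs x U by exact: open_nbhs_nbhs.
(* The radius is below e / 2: any [y] in the cube and [x] itself are both that close to the centre,
   hence within e of each other. *)
have [k _ /(_ k (leqnn k)) ke] :=
  near_infty_natSinv_lt (PosNum (divr_gt0 e0 (ltr0Sn R 1))).
have k0 : 0 < k.+1%:R^-1 :> R by rewrite invr_gt0.
have H i : {q : rat | `|x ord0 i - ratr q| < k.+1%:R^-1}.
  apply: cid.
  have : x ord0 i - k.+1%:R^-1 < x ord0 i + k.+1%:R^-1 by rewrite ltrD2l gtrN.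
  move=> /rat_in_itvoo[q]; rewrite in_itv/= => /andP[q1 q2]; exists q.
  by rewrite distrC ltr_distl q1 q2.
pose q : 'rV[rat]_n := \row_i projT1 (H i).
have Bx : B (q, k) x.
  move=> i /=; rewrite in_itv/= !mxE.
  by have := projT2 (H i); rewrite /= ltr_distl.
exists (q, k) => //; rewrite /F; case: asboolP => //; case.
move=> y By; apply: xeU; split=> // j i; rewrite (ord1 j).
have := By i; have := Bx i; rewrite /= !in_itv/= -!ltr_distl /ball/=.
rewrite distrC => h1 h2; rewrite distrC.
apply: (le_lt_trans (ler_distD (ratr (q ord0 i)) _ _)).
by rewrite (lt_le_trans (ltrD h2 h1))// [leRHS]splitr lerD// ltW.
Qed.

Lemma continuous_measurable_rV n (f : 'rV[R]_n -> R) :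
  continuous f -> measurable_fun setT f.
Proof.
move=> cf; apply: (measurability _ (RGenOpens.measurableE R)) => _ [_ [a [b ->] <-]].
rewrite setTI; apply: open_measurable_rV.
by move/continuousP: cf; apply; exact: interval_open.
Qed.

(** Boxes are stable under intersection, which coordinate preimages are not; this generating family
    is the one that uniqueness of measures calls for. A coordinate preimage is a box with all other
    sides equal to R. *)
Lemma measurable_rV_boxesE n :
  @measurable _ ('rV[R]_n : measurableType _) =
  <<s [set X | exists2 A : 'I_n -> set R,
        (forall i, measurable (A i : set (measurableTypeR R))) & X = box_rV A] >>.
Proof.
apply/seteqP; split; last first.
  apply: smallest_sub; first exact: sigma_algebra_measurable.
  by move=> _ [A mA ->]; exact: measurable_box_rV.
apply: smallest_sub; first exact: smallest_sigma_algebra.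
rewrite -bigcup_seq; apply: bigcup_sub => i _ _ [B mB <-].
apply: sub_sigma_algebra; rewrite setTI.
exists (fun j => if j == i then B else setT) => [j|]; first by case: ifP.
apply/seteqP; split => x /=.
  by move=> Bx j; case: eqP => [->|].
by move=> /(_ i); rewrite eqxx.
Qed.

End rV_measurability.

(** * Lebesgue measure as a product along an arbitrary coordinate *)

Section insert_coordinate.
Context {R : realType} {m : nat} (i : 'I_m.+1).

Definition ins_rV (z : measurableTypeR R * 'rV[R]_m) : 'rV[R]_m.+1 :=
  \row_j oapp (z.2 ord0) z.1 (unlift i j).

Lemma ins_rV_eq z : ins_rV z ord0 i = z.1.
Proof. by rewrite mxE unlift_none. Qed.

Lemma ins_rV_lift z j : ins_rV z ord0 (lift i j) = z.2 ord0 j.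
Proof. by rewrite mxE liftK. Qed.

Lemma measurable_ins_rV : measurable_fun setT ins_rV.
Proof.
apply: measurable_fun_rVP => j.
under eq_fun do rewrite mxE.
case: unliftP => [k|] _ /=; last exact: measurable_fst.
exact: (measurableT_comp (measurable_coord k) measurable_snd).
Qed.

HB.instance Definition _ := isMeasurableFun.Build _ _ _ _ ins_rV measurable_ins_rV.

(** [lebesgue_rV] is built by splitting off coordinate 0; Fubini is wanted along every axis. The two
    measures agree on boxes, because the product of side lengths does not depend on the order of the
    factors, and hence everywhere. *)
Lemma lebesgue_rV_ins (A : set 'rV[R]_m.+1) : measurable A ->
  pushforward (lebesgue_measure \x lebesgue_rV R m)%E ins_rV A =
  lebesgue_rV R m.+1 A.
Proof.
have boxE (B : 'I_m.+1 -> set R) :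
    (forall j, measurable (B j : set (measurableTypeR R))) ->
    pushforward (lebesgue_measure \x lebesgue_rV R m)%E ins_rV (box_rV B) =
    lebesgue_rV R m.+1 (box_rV B).
  move=> mB; rewrite lebesgue_rV_box// (bigD1_ord i)//= -lebesgue_rV_box//.
  have mB' : measurable (box_rV (fun j => B (lift i j))).
    exact: measurable_box_rV.
  rewrite -product_measure1E//.
  congr ((lebesgue_measure \x lebesgue_rV R m)%E _).
  apply/seteqP; split => -[a x] /=.
    move=> xB; split => [|j]; first by have := xB i; rewrite ins_rV_eq.
    by have := xB (lift i j); rewrite ins_rV_lift.
  by move=> [aB xB] j; rewrite mxE; case: unliftP => [k|] ->.
(* Cubes of finite measure exhausting the space, as uniqueness of sigma-finite measures requires. *)
pose g k : set 'rV[R]_m.+1 := box_rV (fun=> `[- k%:R, k%:R]%classic).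
apply: (measure_unique _ g (measurable_rV_boxesE m.+1)).
- move=> _ _ [A1 mA1 ->] [A2 mA2 ->].
  exists (fun j => A1 j `&` A2 j); first by move=> j; exact: measurableI.
  apply/seteqP; split => x /=; first by move=> [h1 h2] j; split.
  by move=> h; split => j; have [] := h j.
- by move=> k; exists (fun=> `[- k%:R, k%:R]%classic).
- apply/seteqP; split => // x _.
  have [k _ /(_ k (leqnn k)) xk] := nbhs_infty_ger `|x|.
  exists k => // j; rewrite /= in_itv/= -ler_norml.
  apply: le_trans xk; rewrite [leRHS]mx_normrE.
  exact: (le_bigmax _ (fun ij => `|x ij.1 ij.2|) (ord0, j)).
- by move=> _ [B mB ->]; exact: boxE.
- move=> k; rewrite [ltLHS](boxE (fun=> `[- k%:R, k%:R]%classic)); last first.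
    by move=> j; exact: measurable_itv.
  rewrite lebesgue_rV_box; last by move=> j; exact: measurable_itv.
  rewrite (eq_bigr (fun=> (k%:R + k%:R)%:E)) ?prodEFin ?ltry// => j _.
  rewrite lebesgue_measure_itv/= lte_fin; case: ifPn => [_|].
    by rewrite opprK EFinD.
  by case: k => [|k]; rewrite ?addr0// gtrN// ltr0n.
Qed.

End insert_coordinate.

(** * The squared Euclidean norm, its logarithm and the unit ball *)

Section euclidean_norm.
Context {R : realType} {n : nat}.
Implicit Types x : 'rV[R]_n.

Definition sqn x : R := \sum_(i < n) x ord0 i ^+ 2.

(** This is L = 1 - ln |x|, expressed through |x|^2 to avoid the square root. *)
Definition logr x : R := 1 - ln (sqn x) / 2.

Lemma sqn_ge0 x : 0 <= sqn x.
Proof. by apply: sumr_ge0 => i _; exact: sqr_ge0. Qed.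

Lemma sqn0 : sqn 0 = 0.
Proof. by rewrite /sqn big1// => i _; rewrite mxE expr0n. Qed.

Lemma sqn_eq0 x : (sqn x == 0) = (x == 0).
Proof.
apply/idP/idP => [|/eqP->]; last by rewrite sqn0.
rewrite psumr_eq0 => [/allP h|i _]; last exact: sqr_ge0.
apply/eqP/rowP => i; rewrite mxE.
by have := h i (mem_index_enum _); rewrite /= sqrf_eq0 => /eqP.
Qed.

Lemma sqn_gt0 x : (0 < sqn x) = (x != 0).
Proof. by rewrite lt_def sqn_ge0 andbT sqn_eq0. Qed.

Lemma le_coord_sqn x i : x ord0 i ^+ 2 <= sqn x.
Proof.
rewrite /sqn (bigD1 i)//= lerDl; apply: sumr_ge0 => j _; exact: sqr_ge0.
Qed.

Lemma normr_coord_le x i : `|x ord0 i| <= enorm x.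
Proof. by rewrite -sqrtr_sqr ler_wsqrtr// le_coord_sqn. Qed.

Lemma sqr_enorm x : enorm x ^+ 2 = sqn x.
Proof. by rewrite sqr_sqrtr// sqn_ge0. Qed.

Lemma enorm_ge0 x : 0 <= enorm x.
Proof. exact: sqrtr_ge0. Qed.

Lemma enorm_gt0 x : (0 < enorm x) = (x != 0).
Proof. by rewrite sqrtr_gt0 sqn_gt0. Qed.

Lemma unit_ballE : unit_ball R n = [set x | sqn x < 1].
Proof.
apply/seteqP; split => x /=; rewrite /unit_ball/= -sqr_enorm => h.
  by rewrite expr_lt1// enorm_ge0.
by rewrite -(@expr_lt1 _ 2)// enorm_ge0.
Qed.

Lemma continuous_sqn : continuous sqn.
Proof.
apply: (@continuous_big R 'I_n +%R 0 xpredT (@add_continuous R) _ _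
  (fun i (y : 'rV[R]_n) => y ord0 i ^+ 2)) => i _ x.
apply: (@continuous_comp _ _ _ (fun y : 'rV[R]_n => y ord0 i) (fun t => t ^+ 2)).
  exact: coord_continuous.
exact: exprn_continuous.
Qed.

Lemma measurable_sqn : measurable_fun setT sqn.
Proof. by apply: continuous_measurable_rV; exact: continuous_sqn. Qed.

Lemma open_unit_ball : open (unit_ball R n).
Proof.
rewrite unit_ballE; apply: (@open_comp _ _ sqn [set t | t < 1]).
  by move=> x _; exact: continuous_sqn.
exact: open_lt.
Qed.

Lemma measurable_unit_ball : measurable (unit_ball R n).
Proof. by apply: open_measurable_rV; exact: open_unit_ball. Qed.

Lemma measurable_logr : measurable_fun setT logr.
Proof.
apply: measurable_funB; first exact: measurable_cst.
apply: measurable_funM; last exact: measurable_cst.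
exact: (measurableT_comp (@measurable_ln R) measurable_sqn).
Qed.

Lemma logr0 : logr 0 = 1.
Proof. by rewrite /logr sqn0 ln0// mul0r subr0. Qed.

Lemma logr_ge1 x : sqn x <= 1 -> 1 <= logr x.
Proof.
by move=> x1; rewrite /logr lerBrDl gerDr pmulr_lle0// ln_le0.
Qed.

End euclidean_norm.

(** * Integrability near the origin by summation over exponential shells *)

Section shells.
Context {R : realType} {n : nat}.
Local Notation leb := (lebesgue_rV R n).

Definition shell k : set 'rV[R]_n :=
  [set x | expR (- (k.+1)%:R) ^+ 2 < sqn x <= expR (- k%:R) ^+ 2].

Lemma measurable_shell k : measurable (shell k).
Proof.
rewrite (_ : shell k = sqn @^-1`
  `](expR (- (k.+1)%:R) ^+ 2), (expR (- k%:R) ^+ 2)]%classic).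
  by rewrite -[X in measurable X]setTI; apply: measurable_sqn.
by apply/seteqP; split => x; rewrite /shell /= in_itv.
Qed.

Lemma trivIset_shell : trivIset setT shell.
Proof.
apply/trivIsetP => i j _ _; wlog ij : i j / (i < j)%N => [H|_].
  move=> /[dup]; rewrite {1}neq_ltn => /orP[ij _|ij _].
    by apply: H => //; rewrite neq_ltn ij.
  by rewrite setIC; apply: H => //; rewrite neq_ltn ij.
apply/seteqP; split => // x [/andP[+ _] /andP[_ +]].
move=> /lt_le_trans/[apply].
by rewrite ltr_pXn2r ?nnegrE ?expR_ge0// ltr_expR ltrN2 ltr_nat ltnNge ij.
Qed.

Lemma bigcup_shell : \bigcup_k shell k = [set x | 0 < sqn x <= 1].
Proof.
apply/seteqP; split => x.
  move=> [k _ /andP[h1 h2]]; rewrite /= (lt_trans _ h1) ?exprn_gt0 ?expR_gt0//=.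
  by rewrite (le_trans h2)// exprn_ile1 ?expR_ge0// expR_le1 oppr_le0.
(* Here t = - ln |x|, and its integer part is the index of the shell containing [x]. *)
move=> /= /andP[x0 x1]; pose t := - ln (sqn x) / 2.
have t0 : 0 <= t by rewrite divr_ge0// oppr_ge0 ln_le0.
have /andP[h1 h2] := truncn_itv t0.
exists (Num.truncn t) => //; rewrite /shell /= -!expRM_natl.
rewrite -ler_ln ?posrE ?expR_gt0// expRK -[X in X && _]ltr_ln ?posrE ?expR_gt0//.
rewrite expRK; move: h1 h2; rewrite /t; lra.
Qed.

(** The shell lies in the cube [- e^(-k), e^(-k)]^n; this crude bound has the right order in k. *)
Lemma lebesgue_shell k : (leb (shell k) <= ((2 * expR (- k%:R)) ^+ n)%:E)%E.
Proof.
pose e := expR (- k%:R) : R.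
have e0 : 0 < e by exact: expR_gt0.
pose A (i : 'I_n) := `[- e, e]%classic.
have mA i : measurable (A i : set (measurableTypeR R)) by exact: measurable_itv.
apply: (@le_trans _ _ (leb (box_rV A))).
  apply: le_measure; rewrite ?inE; [exact: measurable_shell|exact: measurable_box_rV|].
  move=> x /andP[_ xk] i; rewrite /A /= in_itv/= -ler_norml.
  rewrite (le_trans (normr_coord_le _ _))//.
  by rewrite -(@ler_pXn2r _ 2) ?nnegrE ?enorm_ge0 ?expR_ge0// sqr_enorm.
rewrite lebesgue_rV_box// (eq_bigr (fun=> (2 * e)%:E)) => [|i _].
  by rewrite prodEFin lee_fin prodr_const card_ord.
by rewrite lebesgue_measure_itv/= lte_fin gtrN// opprK mulr_natl mulr2n EFinD.
Qed.

(** Comparison with the integral of t^(-3/2), in discrete form: the sharper bound 3 - 2 / sqrt N for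
    N terms, an equality at N = 1, passes through the induction. *)
Lemma sum_inv_mul_sqrt (N : nat) :
  \sum_(0 <= k < N) (k.+1%:R * Num.sqrt k.+1%:R)^-1 <= 3 :> R.
Proof.
case: N => [|N]; first by rewrite big_nil.
suff : \sum_(0 <= k < N.+1) (k.+1%:R * Num.sqrt k.+1%:R)^-1 <=
       3 - 2 / Num.sqrt N.+1%:R :> R.
  by move=> /le_trans; apply; rewrite gerBl divr_ge0// sqrtr_ge0.
elim: N => [|N IHN]; first by rewrite big_nat1 sqrtr1; lra.
rewrite big_nat_recr//=; apply: (le_trans (lerD IHN (lexx _))).
(* With a and b the two consecutive square roots, b^2 = a^2 + 1, and clearing denominators leaves
   the polynomial inequality a + 2 a b^2 <= 2 b^3. *)
have H (k : nat) : exists2 a : R, a = Num.sqrt k.+1%:R & 0 < a /\ a ^+ 2 = k.+1%:R.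
  by exists (Num.sqrt k.+1%:R) => //; rewrite sqrtr_gt0 ltr0n sqr_sqrtr.
have [a <- [a0 a2]] := H N; have [b <- [b0 b2]] := H N.+1.
have ba : b ^+ 2 = a ^+ 2 + 1 by rewrite a2 b2 -natr1.
have ab : a < b by rewrite -(@ltr_pXn2r _ 2) ?nnegrE ?ltW// ba ltrDl.
rewrite -b2 -(@ler_pM2r _ (a * b ^+ 3)) ?mulr_gt0 ?exprn_gt0//.
have -> : (3 - 2 / a + (b ^+ 2 * b)^-1) * (a * b ^+ 3) =
  3 * (a * b ^+ 3) - 2 * b ^+ 3 + a by field; lra.
have -> : (3 - 2 / b) * (a * b ^+ 3) = 3 * (a * b ^+ 3) - 2 * a * b ^+ 2.
  by field; lra.
nra.
Qed.

(* On the k-th shell the bound is of order e^(k n) / k^(3/2), while the measure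
   of the shell is of order e^(- k n). *)
Lemma integrable_unit_ball (f : 'rV[R]_n -> R) (C : R) :
  measurable_fun setT f -> f 0 = 0 ->
  (forall x, 0 < sqn x <= 1 ->
    `|f x| <= C / (enorm x ^+ n * (logr x * Num.sqrt (logr x)))) ->
  leb.-integrable (unit_ball R n) (EFin \o f).
Proof.
move=> mf f0 fC.
have mabs : measurable_fun setT (fun x => `|(f x)%:E|%E).
  by apply: measurableT_comp => //; exact/measurable_EFinP.
have mB := @measurable_unit_ball R n.
apply/integrableP; split.
  by apply/measurable_EFinP; exact: measurable_funTS.
have mD : measurable (\bigcup_k shell k).
  by apply: bigcup_measurable => k _; exact: measurable_shell.
(* The shells cover the ball except for the origin, where [f] vanishes, so the comparison of the
   restricted integrands is pointwise. *)
apply: (@le_lt_trans _ _ (\int[leb]_(x in \bigcup_k shell k) `|(f x)%:E|)%E).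
  rewrite integral_mkcond [leRHS]integral_mkcond; apply: ge0_le_integral => //.
  - by move=> x _; apply: erestrict_ge0.
  - exact/(measurable_restrictT _ mB)/measurable_funTS.
  - exact/(measurable_restrictT _ mD)/measurable_funTS.
  - move=> x _; rewrite bigcup_shell !patchE.
    case: ifPn => [xB|_]; last by case: ifPn => _; rewrite ?abse_ge0.
    case: ifPn => // xD; have [x0|x0] := eqVneq (x : 'rV[R]_n) 0.
      by rewrite x0 /= f0 normr0.
    move: xD; rewrite notin_setE /= sqn_gt0 x0 /=; case.
    by move: xB; rewrite inE unit_ballE/= => /ltW.
rewrite ge0_integral_bigcup//; first last.
- exact: trivIset_shell.
- exact: measurable_funTS.
- exact: measurable_shell.
have C0 : 0 <= Num.max C 0 by rewrite le_max lexx orbT.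
(* The volume bound (2 e^(-k))^n, divided by the lower bound e^(-(k+1) n) for |x|^n on the k-th
   shell, is (2 e)^n for every k. The maximum with 0 covers a negative [C]. *)
pose K := Num.max C 0 * (2 * expR 1) ^+ n.
have K0 : 0 <= K by rewrite mulr_ge0// exprn_ge0// mulr_ge0// expR_ge0.
apply: (@le_lt_trans _ _ (\sum_(k <oo) (K * (k.+1%:R * Num.sqrt k.+1%:R)^-1)%:E)%E).
  apply: lee_nneseries => [k _ _|k _]; first exact: integral_ge0.
  pose M : R := Num.max C 0 /
    (expR (- k.+1%:R) ^+ n * (k.+1%:R * Num.sqrt k.+1%:R)).
  have M0 : 0 <= M.
    by rewrite divr_ge0// mulr_ge0 ?exprn_ge0 ?expR_ge0// mulr_ge0 ?sqrtr_ge0.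
  apply: (@le_trans _ _ (\int[leb]_(x in shell k) cst M%:E x)%E).
    apply: ge0_le_integral => //; first exact: measurable_shell.
      exact: measurable_funTS.
    move=> x xk; rewrite lee_fin; have /andP[x1 x2] := xk.
    have xD : 0 < sqn x <= 1.
      by have : (\bigcup_k shell k) x; [exists k|rewrite bigcup_shell].
    (* On this shell ln |x| <= - k, so L is at least k + 1. *)
    have L1 : k.+1%:R <= logr x.
      have : ln (sqn x) <= ln (expR (- k%:R) ^+ 2).
        by rewrite ler_ln ?posrE ?exprn_gt0 ?expR_gt0//; case/andP: xD.
      by rewrite -expRM_natl expRK /logr -(@natr1 _ k); lra.
    have r1 : expR (- k.+1%:R) <= enorm x.
      by rewrite -(@ler_pXn2r _ 2) ?nnegrE ?enorm_ge0 ?expR_ge0// sqr_enorm ltW.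
    apply: (le_trans (fC _ xD)).
    apply: (@le_trans _ _ (Num.max C 0 / (enorm x ^+ n * (logr x * Num.sqrt (logr x))))).
      rewrite ler_wpM2r ?le_max ?lexx// invr_ge0 mulr_ge0 ?exprn_ge0 ?enorm_ge0//.
      by rewrite mulr_ge0 ?sqrtr_ge0// (le_trans _ L1).
    have k1 : 0 < k.+1%:R :> R by rewrite ltr0n.
    have r0 := lt_le_trans (expR_gt0 _) r1.
    have L0 := lt_le_trans k1 L1.
    have P1 : 0 < k.+1%:R * Num.sqrt k.+1%:R :> R by rewrite mulr_gt0// sqrtr_gt0.
    have P2 : 0 < logr x * Num.sqrt (logr x) by rewrite mulr_gt0// sqrtr_gt0.
    rewrite ler_wpM2l// lef_pV2 ?posrE ?(mulr_gt0 _ P1) ?(mulr_gt0 _ P2)//;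
      rewrite ?exprn_gt0 ?expR_gt0//.
    apply: ler_pM; first by rewrite exprn_ge0 ?expR_ge0.
    - by rewrite mulr_ge0 ?sqrtr_ge0.
    - by rewrite lerXn2r ?nnegrE ?expR_ge0 ?enorm_ge0.
    - by rewrite ler_pM ?sqrtr_ge0 ?ler_wsqrtr.
  rewrite integral_cst; last exact: measurable_shell.
  apply: (le_trans (lee_pmul _ _ (lexx M%:E) (lebesgue_shell k))) => //.
  rewrite -EFinM lee_fin /M /K.
  set a := k.+1%:R * _.
  have -> : expR (- k%:R) = expR (- k.+1%:R) * expR 1 :> R.
    by rewrite -expRD -natr1; congr expR; ring.
  set e := expR (- k.+1%:R).
  have e0 : e ^+ n != 0 by rewrite expf_neq0// gt_eqF// expR_gt0.
  have -> : (2 * (e * expR 1)) ^+ n = (2 * expR 1) ^+ n * e ^+ n :> R.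
    by rewrite -exprMn; congr (_ ^+ _); ring.
  have a0 : a != 0 by rewrite mulf_neq0// sqrtr_eq0 -ltNge.
  move: e0 a0; rewrite le_eqVlt => e0 a0; apply/orP; left; apply/eqP.
  by field; rewrite e0 a0.
apply: (@le_lt_trans _ _ (K * 3)%:E); last exact: ltry.
apply: lime_le.
  apply: is_cvg_nneseries => k _ _.
  by rewrite lee_fin mulr_ge0// invr_ge0 mulr_ge0// sqrtr_ge0.
apply: nearW => N; rewrite sumEFin lee_fin -mulr_sumr ler_wpM2l//.
exact: sum_inv_mul_sqrt.
Qed.

End shells.

(** The inverse is continuous off 0, and the point 0, where it takes the value 0, is split off. *)
Lemma measurable_invr {R : realType} : measurable_fun [set: R] (@GRing.inv R).
Proof.
rewrite -(setvU [set 0]); apply/measurable_funU.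
- exact: measurableC.
- exact: measurable_set1.
split; last exact: measurable_fun_set1.
apply: open_continuous_measurable_fun; first exact/closed_openC/closed_eq.
by move=> x /[!inE] /eqP x0; exact: inv_continuous.
Qed.

(** * The two integrable majorants: |x|^(-2) and the n/2-th power of 1 / (s L) *)

Section integrability_at_origin.
Context {R : realType} {n : nat} (hn : (3 <= n)%N).
Local Notation leb := (lebesgue_rV R n).
Implicit Types x : 'rV[R]_n.

(** With a = sqrt t, the inequality ln (1 / a) <= 1 / a - 1 gives a (1 - ln t) <= 2 - a; then
    square. *)
Lemma mul_sqr_log_le (t : R) : 0 < t -> t <= 1 -> t * (1 - ln t) ^+ 2 <= 4.
Proof.
move=> t0 t1; set a := Num.sqrt t.
have a0 : 0 < a by rewrite sqrtr_gt0.
have ta : t = a ^+ 2 by rewrite sqr_sqrtr// ltW.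
have lnt0 : ln t <= 0 by rewrite ln_le0.
have : ln a^-1 <= a^-1 - 1.
  rewrite lerBrDr -[leRHS]lnK ?posrE ?invr_gt0// [leLHS]addrC.
  by rewrite expR_ge1Dx.
rewrite lnV ?posrE// => lna.
have lnt : ln t = ln a *+ 2 by rewrite ta lnXn.
have aL : a * (1 - ln t) <= 2.
  have : a * (1 - ln t) <= a * (1 + 2 * (a^-1 - 1)).
    by rewrite ler_pM2l// lnt; lra.
  have -> : a * (1 + 2 * (a^-1 - 1)) = 2 - a by field; lra.
  by lra.
have -> : t * (1 - ln t) ^+ 2 = (a * (1 - ln t)) ^+ 2 by rewrite ta; ring.
rewrite (_ : 4 = 2 ^+ 2); last by ring.
by rewrite lerXn2r ?nnegrE// mulr_ge0 ?ltW//; lra.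
Qed.

Lemma logr_enorm x : logr x = 1 - ln (enorm x).
Proof.
have [->|x0] := eqVneq x 0.
  rewrite logr0 /enorm -/(sqn 0) sqn0 sqrtr0 ln0// subr0//.
by rewrite /logr -sqr_enorm lnXn ?enorm_gt0// -mulr_natr; field.
Qed.

(** The shell criterion asks for |x|^(n-2) L^(3/2) <= 4. As |x| <= 1 <= L and n >= 3, the left side
    is at most |x| L^2, and [mul_sqr_log_le] supplies the constant 4. *)
Lemma integrable_inv_sqn :
  leb.-integrable (unit_ball R n) (EFin \o (fun x => (sqn x)^-1)).
Proof.
apply: (@integrable_unit_ball R n _ 4).
- exact: (measurableT_comp (@measurable_invr R) measurable_sqn).
- by rewrite sqn0 invr0.
- move=> x /andP[x0 x1].
  have L1 := logr_ge1 x1.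
  have r0 : 0 < enorm x by rewrite enorm_gt0 -sqn_gt0.
  have r1 : enorm x <= 1.
    by rewrite -(@expr_le1 _ 2)// ?sqr_enorm// ltW.
  have L0 : 0 < logr x by exact: lt_le_trans L1.
  rewrite ger0_norm ?invr_ge0 ?sqn_ge0//.
  rewrite ler_pdivlMr ?mulr_gt0 ?exprn_gt0 ?(sqrtr_gt0 (logr x))//.
  rewrite mulrC ler_pdivrMr// -sqr_enorm.
  have -> : enorm x ^+ n = enorm x ^+ (n - 3) * (enorm x ^+ 2 * enorm x).
    by rewrite -exprSr -exprD; congr (_ ^+ _); rewrite subnK.
  rewrite [X in X <= _](_ : _ =
    enorm x ^+ 2 * (enorm x ^+ (n - 3) *
      (enorm x * (logr x * Num.sqrt (logr x))))); last by ring.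
  rewrite [leRHS]mulrC ler_pM2l ?exprn_gt0//.
  apply: le_trans (mul_sqr_log_le r0 r1); rewrite -logr_enorm.
  apply: (@le_trans _ _ (1 * (enorm x * (logr x * Num.sqrt (logr x))))).
    rewrite ler_wpM2r ?mulr_ge0 ?sqrtr_ge0 ?(ltW r0) ?(ltW L0)//.
    by rewrite exprn_ile1// ltW.
  rewrite mul1r ler_pM2l// expr2 ler_pM2l//.
  rewrite -[leRHS](@ger0_norm _ (logr x)) ?(ltW L0)// -sqrtr_sqr ler_wsqrtr//.
  by rewrite expr2 ler_peMr// ltW.
Qed.

Lemma integrable_le_inv_sqn (f : 'rV[R]_n -> R) (K : R) :
  measurable_fun setT f ->
  (forall x, unit_ball R n x -> `|f x| <= K / sqn x) ->
  leb.-integrable (unit_ball R n) (EFin \o f).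
Proof.
move=> mf fK; have mB := @measurable_unit_ball R n.
apply: (le_integrable mB _ _ (integrableZl mB K integrable_inv_sqn)).
  by apply/measurable_EFinP; exact: measurable_funTS.
move=> x Bx /=; rewrite lee_fin (le_trans (fK _ Bx))//.
exact: ler_norm.
Qed.

(** The factor 1 / (s L) common to the potential and to the derivatives of the solution. *)
Definition hardy x : R := (sqn x * logr x)^-1.

Lemma measurable_hardy : measurable_fun setT hardy.
Proof.
apply: (measurableT_comp (@measurable_invr R)).
by apply: measurable_funM; [exact: measurable_sqn|exact: measurable_logr].
Qed.

Lemma hardy_ge0 x : sqn x <= 1 -> 0 <= hardy x.
Proof.
move=> x1; rewrite invr_ge0 mulr_ge0 ?sqn_ge0//.
exact: le_trans (logr_ge1 x1).
Qed.

(** The left side equals |x|^(-n) L^(-n/2); since L >= 1 and n >= 3, the exponent n / 2 can be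
    lowered to 3 / 2, which the shell criterion still accepts. *)
Lemma powR_hardy_le x : 0 < sqn x <= 1 ->
  hardy x `^ (n%:R / 2) <= 1 / (enorm x ^+ n * (logr x * Num.sqrt (logr x))).
Proof.
move=> /andP[x0 x1]; have L1 := logr_ge1 x1.
have L0 : 0 < logr x by exact: lt_le_trans L1.
have r0 : 0 < enorm x by rewrite enorm_gt0 -sqn_gt0.
rewrite div1r /hardy -powR_inv1; last by rewrite mulr_ge0// ltW.
rewrite -powRrM mulN1r powRN lef_pV2 ?posrE ?powR_gt0 ?mulr_gt0 ?exprn_gt0
  ?(sqrtr_gt0 (logr x))//.
rewrite powRM ?(ltW L0) ?sqn_ge0//.
have -> : sqn x `^ (n%:R / 2) = enorm x ^+ n.
  by rewrite mulrC powRrM powR12_sqrt ?sqn_ge0// powR_mulrn ?sqrtr_ge0.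
rewrite ler_pM2l ?exprn_gt0//.
apply: (@le_trans _ _ (logr x `^ (3 / 2))).
  rewrite (_ : 3 / 2 = 1 + 2^-1); last by field.
  rewrite powRD; last by rewrite gt_eqF ?implybT.
  by rewrite powRr1 ?(ltW L0)// powR12_sqrt ?(ltW L0).
by apply: ler_powR => //; rewrite ler_pM2r ?invr_gt0// ler_nat.
Qed.

Lemma integrable_powR_hardy :
  leb.-integrable (unit_ball R n) (EFin \o (fun x => hardy x `^ (n%:R / 2))).
Proof.
apply: (@integrable_unit_ball R n _ 1).
- exact: (measurableT_comp (@measurable_powR R _) measurable_hardy).
(* At the origin the base is 0, and its power is 0 because the exponent n / 2 is nonzero. *)
- rewrite /hardy sqn0 mul0r invr0 powR0// mulf_neq0// pnatr_eq0.
  by rewrite -lt0n (leq_trans _ hn).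
- by move=> x x1; rewrite ger0_norm ?powR_ge0//; exact: powR_hardy_le.
Qed.

End integrability_at_origin.

(** * Vanishing and boundedness of test functions and their derivatives *)

Section test_functions.
Context {R : realType} {n : nat} (Omega : set 'rV[R]_n) (phi : 'rV[R]_n -> R).
Hypothesis phiP : test_function Omega phi.

(** The complement of the closed support is open, so [phi] vanishes on a whole neighbourhood of
    [x]. *)
Lemma test_partial_eq0 i x : ~ Omega x -> partial i phi x = 0.
Proof.
have [_ _ tO] := phiP => Ox; rewrite /partial -(derive_cst 0 x (delta_mx ord0 i)).
apply: near_eq_derive.
have : nbhs x (~` tsupport phi).
  apply: open_nbhs_nbhs; split; last by move=> /tO.
  exact/closed_openC/closed_closure.
apply: filterS => y ty /=; apply/eqP/negP => /negP py; apply: ty.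
exact: subset_closure.
Qed.

Lemma test_eq0 x : ~ Omega x -> phi x = 0.
Proof.
have [_ _ tO] := phiP => Ox; apply/eqP/negP => /negP py; apply: Ox.
by apply: tO; exact: subset_closure.
Qed.

Lemma test_bounded_aux (f : 'rV[R]_n -> R) : continuous f ->
  (forall x, ~ tsupport phi x -> f x = 0) -> exists M, forall x, `|f x| <= M.
Proof.
have [_ cphi _] := phiP => cf f0.
have /compact_bounded[M [_ /(_ (M + 1))]] : compact (f @` tsupport phi).
  by apply: continuous_compact => //; exact: continuous_subspaceT.
rewrite ltrDl => /(_ ltr01) h; exists (Num.max 0 (M + 1)) => x.
rewrite le_max; have [tx|/f0->] := pselect (tsupport phi x).
  by rewrite h ?orbT//; exists x.
by rewrite normr0 lexx.
Qed.

End test_functions.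

Lemma test_bounded {R : realType} {n} (Omega : set 'rV[R]_n) phi :
  test_function Omega phi -> exists M, forall x, `|phi x| <= M.
Proof.
move=> phiP; have [sphi _ _] := phiP; apply: (test_bounded_aux phiP).
  exact: (sphi [::]).1.
(* [phi] is also a test function on its own support, which turns vanishing off Omega into vanishing
   off the support. *)
have phiP' : test_function (tsupport phi) phi by have [? ? _] := phiP; split.
by move=> x; exact: test_eq0 phiP' x.
Qed.

Lemma test_partial_bounded {R : realType} {n} (Omega : set 'rV[R]_n) phi i :
  test_function Omega phi -> exists M, forall x, `|partial i phi x| <= M.
Proof.
move=> phiP; have [sphi _ _] := phiP; apply: (test_bounded_aux phiP).
  exact: (sphi [:: i]).1.
have phiP' : test_function (tsupport phi) phi by have [? ? _] := phiP; split.
by move=> x; exact: test_partial_eq0 phiP' i x.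
Qed.

(** * Restriction to lines parallel to an axis, and integration by parts there *)

Section line_restriction.
Context {R : realType} {m : nat} (i : 'I_m.+1) (y : 'rV[R]_m).

Lemma ins_rVD (h t : R) :
  ins_rV i (h + t, y) = h *: delta_mx ord0 i + ins_rV i (t, y).
Proof.
apply/rowP => j; rewrite !mxE eqxx/=.
case: unliftP => [k ->|->] /=.
  by rewrite eq_sym (negbTE (neq_lift _ _)) mulr0 add0r.
by rewrite eqxx mulr1.
Qed.

(** Both derivatives are limits of the same difference quotients, by [ins_rVD]. *)
Lemma is_derive_line (f : 'rV[R]_m.+1 -> R) (t : R) :
  derivable f (ins_rV i (t, y)) (delta_mx ord0 i) ->
  is_derive t 1 (fun t => f (ins_rV i (t, y))) (partial i f (ins_rV i (t, y))).
Proof.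
have E : (fun h : R => h^-1 *: (((fun t => f (ins_rV i (t, y))) \o shift t) (h *: 1)
      - f (ins_rV i (t, y)))) =
    (fun h => h^-1 *: ((f \o shift (ins_rV i (t, y))) (h *: delta_mx ord0 i)
      - f (ins_rV i (t, y)))).
  by apply/funext => h /=; rewrite [h%:A]mulr1 ins_rVD.
by move=> df; split; rewrite /derivable /partial /derive E.
Qed.

Lemma sqn_ins_rV (t : R) : sqn (ins_rV i (t, y)) = t ^+ 2 + sqn y.
Proof.
rewrite /sqn (bigD1_ord i)//= ins_rV_eq; congr (_ + _).
by apply: eq_bigr => j _; rewrite ins_rV_lift.
Qed.

End line_restriction.

Lemma set1_rV0 {R : realType} {m : nat} :
  [set (0 : 'rV[R]_m)] = box_rV (fun=> [set 0]).
Proof.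
apply/seteqP; split => x /=; first by move=> -> j; rewrite mxE.
by move=> x0; apply/rowP => j; rewrite mxE x0.
Qed.

Lemma measurable_rV_set0 {R : realType} {m : nat} :
  measurable [set (0 : 'rV[R]_m)].
Proof.
by rewrite set1_rV0; apply: measurable_box_rV => j; exact: measurable_set1.
Qed.

Lemma lebesgue_rV_set0 {R : realType} {m : nat} : (0 < m)%N ->
  lebesgue_rV R m [set 0] = 0%E.
Proof.
case: m => // m _; rewrite set1_rV0 lebesgue_rV_box//.
by rewrite big_ord_recl lebesgue_measure_set1 mul0e.
Qed.

Lemma continuous_is_derive {R : realType} (f g : R -> R) (t : R) :
  is_derive t 1 f (g t) -> {for t, continuous f}.
Proof.
move=> [df _]; apply: differentiable_continuous; exact/derivable1_diffP.
Qed.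

(** The integrand is the derivative of f p, and [p] vanishes at both ends. *)
Lemma integral_line_eq0 {R : realType} (f g p q : R -> R) (a b : R) : a < b ->
  (forall t : R, a <= t <= b -> is_derive t 1 f (g t)) ->
  (forall t : R, a <= t <= b -> {for t, continuous g}) ->
  (forall t : R, is_derive t 1 p (q t)) -> continuous q -> p a = 0 -> p b = 0 ->
  (\int[lebesgue_measure]_(t in `[a, b]) (f t * q t + g t * p t)%:E)%E = 0%E.
Proof.
move=> ab dfg cg dpq cq pa pb.
have cf (t : R) : a <= t <= b -> {for t, continuous f}.
  by move=> /dfg; exact: continuous_is_derive.
have cp (t : R) : {for t, continuous p} by exact: continuous_is_derive (dpq t).
have dF (t : R) : a <= t <= b -> is_derive t 1 (f * p) (f t * q t + g t * p t).
  move=> tab; have := dfg _ tab; have := dpq t => dp df.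
  by apply: is_derive_eq; rewrite /GRing.scale/= [g t * _]mulrC.
rewrite (@continuous_FTC2 _ _ (f * p) a b ab).
- by rewrite /GRing.mul/= pa pb !mulr0 subee.
- apply: continuous_in_subspaceT => t; rewrite inE/= in_itv/= => tab.
  apply: cvgD; apply: cvgM; [exact: cf|exact: cq|exact: cg|exact: cp].
- have cFp t : a <= t <= b -> {for t, continuous (f * p)}.
    by move=> tab; apply: cvgM; [exact: cf|exact: cp].
  split.
  + move=> t /[!in_itv]/= /andP[h1 h2]; apply: (@ex_derive _ _ _ _ _ _ _ (dF t _)).
    by rewrite !ltW.
  + by apply: cvg_at_right_filter; apply: cFp; rewrite lexx ltW.
  + by apply: cvg_at_left_filter; apply: cFp; rewrite lexx ltW.
- move=> t /[!in_itv]/= /andP[h1 h2]; rewrite derive1E.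
  by have [|_ ->//] := dF t; rewrite !ltW.
Qed.

(** * Integration by parts in the ball for functions singular at the origin *)

Section integration_by_parts_off_origin.
Context {R : realType} {m : nat} (hm : (2 <= m)%N) (i : 'I_m.+1).
Local Notation leb := (lebesgue_rV R m.+1).
Local Notation ball := (unit_ball R m.+1).

(* Almost every line parallel to the i-th axis avoids the origin. *)
Lemma integration_by_parts_off_origin (F G phi : 'rV[R]_m.+1 -> R) (K : R) :
  measurable_fun setT F -> measurable_fun setT G ->
  (forall x, ball x -> `|F x| <= K / sqn x) ->
  (forall x, ball x -> `|G x| <= K / sqn x) ->
  (forall (y : 'rV[R]_m) (t : R), 0 < sqn y < 1 -> -1 <= t <= 1 ->
    is_derive t 1 (fun t => F (ins_rV i (t, y))) (G (ins_rV i (t, y)))) ->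
  (forall (y : 'rV[R]_m) (t : R), 0 < sqn y < 1 -> -1 <= t <= 1 ->
    {for t, continuous (fun t => G (ins_rV i (t, y)))}) ->
  test_function ball phi ->
  [/\ leb.-integrable ball (EFin \o (fun x => F x * partial i phi x)),
      leb.-integrable ball (EFin \o (fun x => G x * phi x)) &
    \int[leb]_(x in ball) (F x * partial i phi x) =
    - \int[leb]_(x in ball) (G x * phi x)].
Proof.
move=> mF mG FK GK dFG cG phiP; have [sphi cphi tphi] := phiP.
have mphi : measurable_fun setT phi.
  by apply: continuous_measurable_rV; exact: (sphi [::]).1.
have mdphi : measurable_fun setT (partial i phi).
  by apply: continuous_measurable_rV; exact: (sphi [:: i]).1.
have [M phiM] := test_bounded phiP.
have [N dphiN] := test_partial_bounded i phiP.
have mB := @measurable_unit_ball R m.+1.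
have intbound (f g : 'rV[R]_m.+1 -> R) C :
    measurable_fun setT f -> measurable_fun setT g ->
    (forall x, ball x -> `|f x| <= K / sqn x) -> (forall x, `|g x| <= C) ->
    leb.-integrable ball (EFin \o (fun x => f x * g x)).
  move=> mf mg fK gC; apply: (@integrable_le_inv_sqn _ _ _ _ (K * C)) => //.
    exact: measurable_funM.
  move=> x Bx; rewrite normrM mulrAC.
  by apply: ler_pM => //; exact: fK.
have iF := intbound _ _ _ mF mdphi FK dphiN.
have iG := intbound _ _ _ mG mphi GK phiM.
split => //; apply/eqP; rewrite -addr_eq0 -RintegralD//; apply/eqP.
(* Both sides are merged into one integral, to be shown zero. [H] vanishes off the ball, so it may
   be integrated over the whole space, where Fubini applies. *)
pose H x := F x * partial i phi x + G x * phi x.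
have mH : measurable_fun setT (EFin \o H).
  by apply/measurable_EFinP/measurable_funD; exact: measurable_funM.
have H0 x : ~ ball x -> H x = 0.
  by move=> Bx; rewrite /H (test_partial_eq0 phiP)// (test_eq0 phiP)// !mulr0 addr0.
have iH : leb.-integrable setT (EFin \o H).
  have : leb.-integrable ball (EFin \o H) by exact: (integrableD mB iF iG).
  rewrite integrable_mkcond// (_ : _ \_ _ = EFin \o H)//.
  apply/funext => x; rewrite patchE; case: ifPn => //.
  by rewrite notin_setE /= => /H0 ->.
suff HE : (\int[leb]_x (EFin \o H) x = 0)%E.
  rewrite /Rintegral (_ : (\int[_]_(x in _) _)%E = 0%E)//.
  rewrite -[RHS]HE [LHS]integral_mkcond; apply: eq_integral => x _.
  rewrite patchE; case: ifPn => //.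
  by rewrite notin_setE /= => /H0; rewrite /H => ->.
(* This makes the i-th coordinate the inner variable of the iterated integral. *)
have pushE A : measurable A -> A `<=` setT -> leb A =
    pushforward (lebesgue_measure \x lebesgue_rV R m)%E (ins_rV i) A.
  by move=> mA _; rewrite (@lebesgue_rV_ins R m i).
have iHi : (lebesgue_measure \x lebesgue_rV R m)%E.-integrable setT
    ((EFin \o H) \o ins_rV i).
  apply/integrableP; split.
    by apply: measurableT_comp => //; exact: measurable_ins_rV.
  have /integrableP[_] := iH; rewrite (eq_measure_integral _ pushE).
  rewrite ge0_integral_pushforward//.
  exact: measurableT_comp.
rewrite (eq_measure_integral _ pushE) integral_pushforward//.
rewrite preimage_setT -integral21_prod_meas1//.
rewrite (ae_eq_integral (cst 0%E)) ?integral0//; first exact: (measurable_fubini_G iHi).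
(* The only exceptional line is the axis itself, y = 0, a null set of parameters since m > 0. *)
exists [set (0 : 'rV[R]_m)]; split; first exact: measurable_rV_set0.
  by apply: lebesgue_rV_set0; exact: leq_trans hm.
move=> y /= Gy; apply: contrapT => /eqP y0; apply: Gy => _.
have {}y0 : 0 < sqn y by rewrite sqn_gt0.
(* A line at distance at least 1 from the origin misses the open ball. *)
rewrite /fubini_G; have [y1|y1] := leP 1 (sqn y).
  apply: integral0_eq => t _ /=; rewrite H0// unit_ballE /= sqn_ins_rV.
  by apply/negP; rewrite -leNgt ler_wpDl// sqr_ge0.
have y01 : 0 < sqn y < 1 by rewrite y0.
have out t : 1 <= `|t| -> ~ ball (ins_rV i (t, y)).
  move=> t1; rewrite unit_ballE /= sqn_ins_rV.
  apply/negP; rewrite -leNgt ler_wpDr ?(ltW y0)//.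
  by rewrite -real_normK ?num_real// exprn_ege1.
(* The segment [-1, 1] contains the part of the line inside the ball, and its endpoints lie outside,
   where [phi] is 0. *)
rewrite -[RHS](@integral_line_eq0 R (fun t => F (ins_rV i (t, y)))
  (fun t => G (ins_rV i (t, y))) (fun t => phi (ins_rV i (t, y)))
  (fun t => partial i phi (ins_rV i (t, y))) (-1) 1).
- rewrite [RHS]integral_mkcond; apply: eq_integral => t _.
  rewrite patchE; case: ifPn => //.
  rewrite notin_setE/= in_itv/= -ler_norml => /negP; rewrite -ltNge => t1.
  by rewrite H0//; apply: out; exact: ltW.
- lra.
- by move=> t; exact: dFG.
- by move=> t; exact: cG.
- by move=> t; apply: is_derive_line; exact: (sphi [::]).2.
- move=> t; apply: (@continuous_is_derive _ _
    (fun t => partial i (partial i phi) (ins_rV i (t, y)))).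
  by apply: is_derive_line; exact: (sphi [:: i]).2.
- by apply: test_eq0 phiP _ _; apply: out; rewrite normrN1.
- by apply: test_eq0 phiP _ _; apply: out; rewrite normr1.
Qed.

End integration_by_parts_off_origin.

(** * Derivatives of the radial profile along a line at squared distance [q] from the origin *)

Section profile_on_lines.
Context {R : realType}.
Variables (eps q : R).
Hypothesis q01 : 0 < q < 1.

(** [S], [L], [U] and [H] are the restrictions to the line of s, L, the solution and 1 / (s L). *)
Let S (t : R) := t ^+ 2 + q.
Let L (t : R) := 1 - ln (S t) / 2.
Let U (t : R) := expR (- eps * ln (L t)).
Let H (t : R) := (S t * L t)^-1.

Let S_gt0 t : 0 < S t.
Proof. by case/andP: q01 => q0 _; rewrite ltr_wpDl// sqr_ge0. Qed.

(** The segment leaves the unit ball, so ln S may be positive; still ln S <= S - 1 <= q < 1, whence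
    L > 1/2. *)
Let L_gt0 t : -1 <= t <= 1 -> 0 < L t.
Proof.
move=> t1; have : ln (S t) <= S t - 1.
  rewrite lerBrDr -[leRHS]lnK ?posrE ?S_gt0// [leLHS]addrC.
  by rewrite expR_ge1Dx.
have : t ^+ 2 <= 1 by case/andP: t1 => *; nra.
by rewrite /L /S; case/andP: q01 => q0 q1 ? ?; lra.
Qed.

Let dS (t : R) : is_derive t 1 S (2 * t).
Proof.
rewrite (_ : S = id ^+ 2 + cst q)//.
by apply: is_derive_eq; rewrite addr0 /= expr1 /GRing.scale/= mulr1 mulr_natl.
Qed.

Let dL (t : R) : is_derive t 1 L (- (t / S t)).
Proof.
have dlnS : is_derive t 1 (@ln R \o S) ((S t)^-1 * (2 * t)).
  exact: (is_derive1_comp (is_derive1_ln (S_gt0 t)) (dS t)).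
rewrite (_ : L = cst 1 - (2^-1) *: (@ln R \o S)); last first.
  by apply/funext => x; rewrite /L /= !fctE /= /GRing.scale/= [_ / 2]mulrC.
apply: is_derive_eq; rewrite sub0r /GRing.scale/=; congr (- _).
by field; rewrite gt_eqF.
Qed.

Let dU (t : R) : -1 <= t <= 1 -> is_derive t 1 U (eps * U t * t * H t).
Proof.
move=> t1; have L0 := L_gt0 t1.
have dlnL : is_derive t 1 (@ln R \o L) ((L t)^-1 * (- (t / S t))).
  exact: (is_derive1_comp (is_derive1_ln L0) (dL t)).
have dsc : is_derive t 1 ((- eps) *: (@ln R \o L))
    ((- eps) *: ((L t)^-1 * (- (t / S t)))).
  exact: is_deriveZ.
rewrite (_ : U = expR \o ((- eps) *: (@ln R \o L)))//.
apply: is_derive_eq (is_derive1_comp (is_derive_expR _) dsc) _.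
rewrite /= -[expR _]/(U t) /H /GRing.scale/=.
by field; rewrite !gt_eqF.
Qed.

(** The derivative of S L is 2 t L - t = t (2 L - 1). *)
Let dH (t : R) : -1 <= t <= 1 ->
  is_derive t 1 H (- (t * (2 * L t - 1) * H t ^+ 2)).
Proof.
move=> t1; have L0 := L_gt0 t1; have S0 := S_gt0 t.
have dSL : is_derive t 1 (S * L) (S t *: (- (t / S t)) + L t *: (2 * t)).
  exact: is_deriveM.
rewrite (_ : H = (fun y => ((S * L) y)^-1))//.
apply: is_derive_eq; first by apply: is_deriveV; rewrite gt_eqF// mulr_gt0.
rewrite /H (_ : (S * L) t = S t * L t)// /GRing.scale/=.
by field; rewrite !gt_eqF.
Qed.

(** The product rule applied to eps U t H, with U' = eps U t H and H' = - t (2 L - 1) H^2. *)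
Definition line_second (t : R) : R := eps * (eps * U t * t ^+ 2 * H t ^+ 2 +
  U t * (H t - t ^+ 2 * (2 * L t - 1) * H t ^+ 2)).

Lemma is_derive_profile (t : R) : -1 <= t <= 1 ->
  is_derive t 1 U (eps * U t * t * H t).
Proof. exact: dU. Qed.

Lemma is_derive_profile2 (t : R) : -1 <= t <= 1 ->
  is_derive t 1 (fun t => eps * U t * t * H t) (line_second t).
Proof.
move=> t1; have := dU t1; have := dH t1 => dh du.
rewrite (_ : (fun t => _) = (eps *: U) * id * H)//.
apply: is_derive_eq; rewrite /line_second.
rewrite (_ : (eps *: U * id) t = eps * U t * t)//.
rewrite (_ : (eps *: U) t = eps * U t)// /GRing.scale/=; ring.
Qed.

Lemma continuous_profile2 (t : R) : -1 <= t <= 1 ->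
  {for t, continuous line_second}.
Proof.
move=> t1.
have cU : {for t, continuous U}.
  exact: (@continuous_is_derive _ _ (fun t => eps * U t * t * H t)) (dU t1).
have cH : {for t, continuous H}.
  exact: (@continuous_is_derive _ _
    (fun t => - (t * (2 * L t - 1) * H t ^+ 2))) (dH t1).
have cL : {for t, continuous L}.
  exact: (@continuous_is_derive _ _ (fun t => - (t / S t))) (dL t).
have cH2 : {for t, continuous (fun t => H t ^+ 2)} by apply: cvgM.
have ct2 : {for t, continuous (fun t : R => t ^+ 2)} by exact: exprn_continuous.
apply: cvgM; first exact: cvg_cst.
apply: cvgD.
  by apply: cvgM => //; apply: cvgM => //; apply: cvgM => //; exact: cvg_cst.
apply: cvgM => //; apply: cvgB => //; apply: cvgM => //; apply: cvgM => //.
by apply: cvgB; [apply: cvgM => //|]; exact: cvg_cst.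
Qed.

End profile_on_lines.

(** * The solution, its derivatives and the potential: pointwise equation and bounds *)

Section solution.
Context {R : realType} {n : nat}.
Implicit Types (eps : R) (x : 'rV[R]_n).

(** The power L^(-eps). The origin is a separate case because [logr 0] is 1, so that the formula
    alone would give 1 there instead of the limit 0. *)
Definition sol eps x : R := if x == 0 then 0 else expR (- eps * ln (logr x)).

Definition grad eps (i : 'I_n) x : R := eps * sol eps x * x ord0 i * hardy x.

(** Off the origin, the pure second derivative of [sol] in direction i, in the same shape as
    [line_second]. *)
Definition grad2 eps (i : 'I_n) x : R :=
  eps * (eps * sol eps x * x ord0 i ^+ 2 * hardy x ^+ 2 +
    sol eps x * (hardy x - x ord0 i ^+ 2 * (2 * logr x - 1) * hardy x ^+ 2)).

(** The product [sqn x * hardy x ^+ 2] stands for 1 / (s L^2). *)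
Definition potential eps x : R :=
  eps * ((n%:R - 2) * hardy x + (1 + eps) * (sqn x * hardy x ^+ 2)).

Lemma sol0 eps : sol eps 0 = 0.
Proof. by rewrite /sol eqxx. Qed.

Lemma hardy0 : hardy (0 : 'rV[R]_n) = 0.
Proof. by rewrite /hardy sqn0 mul0r invr0. Qed.

Lemma logr_gt0 x : sqn x <= 1 -> 0 < logr x.
Proof. by move=> x1; exact: lt_le_trans (logr_ge1 x1). Qed.

Lemma sol_ge0 eps x : 0 <= sol eps x.
Proof. by rewrite /sol; case: ifP => // _; exact: expR_ge0. Qed.

Lemma sol_le1 eps x : 0 < eps -> sqn x <= 1 -> sol eps x <= 1.
Proof.
move=> e0 x1; rewrite /sol; case: ifP => // _.
by rewrite expR_le1 mulNr oppr_le0 mulr_ge0 ?(ltW e0)// ln_ge0// logr_ge1.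
Qed.

Lemma mul_sqn_sqr_hardy x : sqn x <= 1 ->
  sqn x * hardy x ^+ 2 * logr x = hardy x.
Proof.
have [->|x0] := eqVneq x 0; first by rewrite hardy0 expr0n mulr0 mul0r.
move=> /logr_gt0 L0; have s0 : 0 < sqn x by rewrite sqn_gt0.
by rewrite /hardy; field; rewrite !gt_eqF.
Qed.

Lemma mul_sqn_sqr_hardy_le x : sqn x <= 1 -> sqn x * hardy x ^+ 2 <= hardy x.
Proof.
move=> x1; rewrite -[leRHS](mul_sqn_sqr_hardy x1) ler_peMr ?logr_ge1//.
by rewrite mulr_ge0 ?sqn_ge0// sqr_ge0.
Qed.

Lemma hardy_le_inv_sqn x : sqn x <= 1 -> hardy x <= (sqn x)^-1.
Proof.
have [->|x0] := eqVneq x 0; first by rewrite hardy0 sqn0 invr0.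
move=> x1; have L1 := logr_ge1 x1; have s0 : 0 < sqn x by rewrite sqn_gt0.
rewrite lef_pV2 ?posrE ?mulr_gt0 ?logr_gt0//.
by rewrite ler_peMr// ltW.
Qed.

(** Each summand is affine in x_i^2, so the sum involves only n and s. The two sides then differ by
    a multiple of s h^2 L - h, with h = [hardy x], which is zero. *)
Lemma sum_grad2 eps x : sqn x <= 1 ->
  \sum_(i < n) grad2 eps i x = potential eps x * sol eps x.
Proof.
move=> x1; have h := mul_sqn_sqr_hardy x1.
rewrite (eq_bigr (fun i => eps * sol eps x * hardy x +
    eps * sol eps x * hardy x ^+ 2 * (eps - (2 * logr x - 1)) * x ord0 i ^+ 2)).
  rewrite big_split/= sumr_const card_ord -[_ *+ n]mulr_natr.
  rewrite -[X in _ + X]mulr_sumr -/(sqn x).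
  apply/eqP; rewrite -subr_eq0 [X in X == 0](_ : _ = - 2 * eps * sol eps x *
    (sqn x * hardy x ^+ 2 * logr x - hardy x)).
    by rewrite h subrr mulr0.
  by rewrite /potential; ring.
by move=> i _; rewrite /grad2; ring.
Qed.

Lemma measurable_sol eps : measurable_fun setT (sol eps).
Proof.
rewrite /sol; apply: measurable_fun_ifT => //; last first.
  apply: (measurableT_comp (@measurable_expR R)).
  apply: measurable_funM; first exact: measurable_cst.
  exact: (measurableT_comp (@measurable_ln R) (@measurable_logr R n)).
apply: (measurable_fun_bool true); rewrite setTI.
rewrite (_ : _ @^-1` _ = [set (0 : 'rV[R]_n)]); first exact: measurable_rV_set0.
by apply/seteqP; split => x /= => [/eqP|->]; rewrite ?eqxx.
Qed.

Lemma measurable_grad eps i : measurable_fun setT (grad eps i).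
Proof.
apply: measurable_funM; last exact: measurable_hardy.
apply: measurable_funM; last exact: measurable_coord.
by apply: measurable_funM; [exact: measurable_cst|exact: measurable_sol].
Qed.

Lemma measurable_grad2 eps i : measurable_fun setT (grad2 eps i).
Proof.
have mx : measurable_fun setT (fun x : 'rV[R]_n => x ord0 i ^+ 2).
  by apply: measurable_funX; exact: measurable_coord.
have mh : measurable_fun setT (fun x : 'rV[R]_n => hardy x ^+ 2).
  by apply: measurable_funX; exact: measurable_hardy.
have mu := measurable_sol eps.
apply: measurable_funM; first exact: measurable_cst.
apply: measurable_funD.
  by do 3! [apply: measurable_funM => //].
apply: measurable_funM => //; apply: measurable_funB; first exact: measurable_hardy.
apply: measurable_funM => //; apply: measurable_funM => //.
apply: measurable_funB => //; apply: measurable_funM => //.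
exact: measurable_logr.
Qed.

Lemma measurable_potential eps : measurable_fun setT (potential eps).
Proof.
apply: measurable_funM; first exact: measurable_cst.
apply: measurable_funD; (apply: measurable_funM; first exact: measurable_cst).
  exact: measurable_hardy.
apply: measurable_funM; first exact: measurable_sqn.
by apply: measurable_funX; exact: measurable_hardy.
Qed.

Section bounds.
Variables (eps : R) (x : 'rV[R]_n).
Hypotheses (e0 : 0 < eps) (Bx : unit_ball R n x).

Let x1 : sqn x <= 1.
Proof. by move: Bx; rewrite unit_ballE => /ltW. Qed.

(** One constant for all three bounds: 1 serves [sol], eps serves [grad] and eps (eps + 3) serves
    [grad2]. *)
Let K := 1 + eps * (eps + 3).

Let K_ge1 : 1 <= K.
Proof. by rewrite /K lerDl mulr_ge0 ?(ltW e0)// addr_ge0// ltW. Qed.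

Let eps_le_K : eps <= K.
Proof.
have := e0; have : 0 <= eps * eps by rewrite mulr_ge0// ltW.
by rewrite /K; lra.
Qed.

Lemma sol_bound : `|sol eps x| <= K / sqn x.
Proof.
rewrite ger0_norm ?sol_ge0//.
have [->|x0] := eqVneq x 0; first by rewrite sol0 sqn0 invr0 mulr0.
have s0 : 0 < sqn x by rewrite sqn_gt0.
have u1 := sol_le1 e0 x1; have u0 := sol_ge0 eps x.
by rewrite ler_pdivlMr// (le_trans _ K_ge1)// mulr_ile1// sqn_ge0.
Qed.

Lemma normr_coord_le1 i : `|x ord0 i| <= 1.
Proof.
by apply: le_trans (normr_coord_le _ _) _; exact: ltW.
Qed.

Lemma grad_bound i : `|grad eps i x| <= K / sqn x.
Proof.
have h0 := hardy_ge0 x1; have u0 := sol_ge0 eps x; have u1 := sol_le1 e0 x1.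
rewrite /grad !normrM (ger0_norm h0) (ger0_norm u0) (gtr0_norm e0).
apply: ler_pM; rewrite ?mulr_ge0 ?(ltW e0)//; last exact: hardy_le_inv_sqn.
rewrite -mulrA (le_trans _ eps_le_K)// ler_piMr ?(ltW e0)//.
by rewrite mulr_ile1// normr_coord_le1.
Qed.

(** Squaring [grad_bound] would give |x|^(-4), too singular when n is 3 or 4. Instead x_i^2 <= s
    absorbs one factor: x_i^2 h^2 <= s h^2 <= h <= 1 / s, with h = [hardy x]. *)
Lemma sqr_grad_bound i : grad eps i x ^+ 2 <= eps ^+ 2 / sqn x.
Proof.
have u0 := sol_ge0 eps x; have u1 := sol_le1 e0 x1.
have xs := le_coord_sqn x i.
have -> : grad eps i x ^+ 2 =
    eps ^+ 2 * (sol eps x ^+ 2 * x ord0 i ^+ 2 * hardy x ^+ 2).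
  by rewrite /grad; ring.
rewrite ler_pM2l ?exprn_gt0//.
apply: (le_trans _ (hardy_le_inv_sqn x1)).
apply: (le_trans _ (mul_sqn_sqr_hardy_le x1)).
have H0 := sqr_ge0 (hardy x); rewrite ler_wpM2r//.
rewrite (le_trans _ xs)// ler_piMl ?sqr_ge0//.
by rewrite expr_le1.
Qed.

(** With h = [hardy x] and b = x_i^2 h^2, both b and b L are at most h, so the logarithm in [grad2]
    costs nothing. *)
Lemma grad2_bound i : `|grad2 eps i x| <= K / sqn x.
Proof.
have h0 := hardy_ge0 x1; have u0 := sol_ge0 eps x; have u1 := sol_le1 e0 x1.
have hs := hardy_le_inv_sqn x1.
set a := x ord0 i ^+ 2; have a0 : 0 <= a by exact: sqr_ge0.
have ah : a * hardy x ^+ 2 <= sqn x * hardy x ^+ 2.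
  by apply: ler_wpM2r; [exact: sqr_ge0|exact: le_coord_sqn].
have sh := mul_sqn_sqr_hardy_le x1.
have shL := mul_sqn_sqr_hardy x1; have L1 := logr_ge1 x1.
set b := a * hardy x ^+ 2 in ah; have b0 : 0 <= b by rewrite mulr_ge0// sqr_ge0.
have bL : b * logr x <= hardy x.
  by rewrite -[leRHS]shL ler_wpM2r// (le_trans ler01).
have -> : grad2 eps i x =
    sol eps x * (eps * (eps * b + (hardy x - (2 * (b * logr x) - b)))).
  by rewrite /grad2 -/a /b; ring.
have bL0 : 0 <= b * logr x by rewrite mulr_ge0// (le_trans ler01).
rewrite normrM (ger0_norm u0); apply: (@le_trans _ _ (1 * (K * hardy x))); last first.
  by rewrite mul1r ler_wpM2l// (le_trans _ K_ge1).
apply: ler_pM => //.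
rewrite normrM (gtr0_norm e0).
apply: (@le_trans _ _ (eps * ((eps + 3) * hardy x))); last first.
  by rewrite mulrA ler_wpM2r// /K lerDr.
have bh : b <= hardy x by exact: le_trans ah sh.
have ebh : eps * b <= eps * hardy x by rewrite ler_pM2l.
have eb0 : 0 <= eps * b by rewrite mulr_ge0// ltW.
have eh0 : 0 <= eps * hardy x by rewrite mulr_ge0// ltW.
by rewrite ler_pM2l// mulrDl ler_norml; apply/andP; split; lra.
Qed.

Lemma potential_ge0 : (2 <= n)%N -> 0 <= potential eps x.
Proof.
move=> n2; have h0 := hardy_ge0 x1.
rewrite mulr_ge0 ?(ltW e0)// addr_ge0// mulr_ge0//.
- by rewrite subr_ge0 ler_nat.
- by rewrite addr_ge0// ltW.
- by rewrite mulr_ge0 ?sqn_ge0// sqr_ge0.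
Qed.

Lemma potential_le : potential eps x <= eps * (n%:R - 1 + eps) * hardy x.
Proof.
rewrite /potential -mulrA ler_pM2l//.
have : (1 + eps) * (sqn x * hardy x ^+ 2) <= (1 + eps) * hardy x.
  by rewrite ler_wpM2l ?mul_sqn_sqr_hardy_le// addr_ge0// ltW.
by rewrite !mulrDl; lra.
Qed.

End bounds.

End solution.

(** * Membership in L^p of the unit ball *)

Section Lp_unit_ball.
Context {R : realType} {n : nat}.
Local Notation leb := (lebesgue_rV R n).
Local Notation ball := (unit_ball R n).

(** For p > 0 the power of 0 is 0, so extension by zero commutes with taking powers. *)
Lemma Lp_normE (p : R) (f : 'rV[R]_n -> R) : 0 < p ->
  Lp_norm ball p f = ((\int[leb]_(x in ball) (`|f x| `^ p)%:E) `^ p^-1)%E.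
Proof.
move=> p0; rewrite /Lp_norm unlock; congr (_ `^ _)%E.
rewrite [RHS]integral_mkcond; apply: eq_integral => x _ /=.
rewrite !patchE; case: ifPn => _ //=.
by rewrite normr0 powR0// gt_eqF.
Qed.

Lemma in_Lp_unit_ball (p : R) (f : 'rV[R]_n -> R) : 0 < p ->
  measurable_fun setT f ->
  leb.-integrable ball (EFin \o (fun x => `|f x| `^ p)) -> in_Lp ball p f.
Proof.
move=> p0 mf /integrable_lty ify; apply/andP; split; rewrite inE.
  apply/(measurable_restrictT _ measurable_unit_ball).
  exact: measurable_funTS.
suff : (Lp_norm ball p f < +oo)%E by [].
by rewrite Lp_normE//; apply: poweR_lty; apply: ify; exact: measurable_unit_ball.
Qed.

Lemma in_L2_unit_ball (f : 'rV[R]_n -> R) (K : R) : (3 <= n)%N ->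
  measurable_fun setT f -> (forall x, ball x -> f x ^+ 2 <= K / sqn x) ->
  in_Lp ball 2 f.
Proof.
move=> hn mf fK; apply: in_Lp_unit_ball => //.
apply: (@integrable_le_inv_sqn _ _ hn _ K).
  apply: (measurableT_comp (@measurable_powR R 2)).
  exact: (measurableT_comp (@normr_measurable R setT)).
move=> x Bx; rewrite powR_mulrn// real_normK ?num_real// ger0_norm ?sqr_ge0//.
exact: fK.
Qed.

End Lp_unit_ball.

(** * Boundary values and continuity up to the boundary *)

Section boundary_values.
Context {R : realType} {n : nat}.
Local Notation ball := (unit_ball R n).

Lemma closure_unit_ball (x : 'rV[R]_n) : closure ball x -> sqn x <= 1.
Proof.
have cl : closed [set x : 'rV[R]_n | sqn x <= 1].
  apply: (@closed_comp _ _ sqn [set t | t <= 1]); last exact: closed_le.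
  by move=> y _; exact: continuous_sqn.
move=> cx; apply: cl; apply: closureS cx => y.
by rewrite unit_ballE /= => /ltW.
Qed.

Lemma sol_boundary (eps : R) (x : 'rV[R]_n) : boundary ball x -> 1 <= sol eps x.
Proof.
move=> [/closure_unit_ball x1 xi].
have x1' : sqn x = 1.
  apply/eqP; rewrite eq_le x1 leNgt; apply/negP => xlt; apply: xi.
  rewrite /interior; apply: open_nbhs_nbhs; split; first exact: open_unit_ball.
  by rewrite unit_ballE.
rewrite /sol -sqn_eq0 x1' oner_eq0 /logr x1' ln1 mul0r subr0 ln1 mulr0.
by rewrite expR0.
Qed.

Lemma continuous_sol (eps : R) (x : 'rV[R]_n) : 0 < eps -> sqn x <= 1 ->
  {for x, continuous (sol eps)}.
Proof.
move=> e0 x1; have [->|x0] := eqVneq x 0.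
  suff : sol eps y @[y --> (0 : 'rV[R]_n)] --> (0 : R).
    by rewrite /prop_for /continuous_at sol0.
  apply/(@cvgr0Pnorm_lt _ _ _ (nbhs (0 : 'rV[R]_n)) _ (sol eps)) => d d0.
  (* This solves L^(-eps) < d for s: the condition reads L > d^(-1/eps), that is, ln s < 2 (1 -
     d^(-1/eps)). *)
  pose r := expR (2 * (1 - expR (- eps^-1 * ln d))).
  have : \forall y \near (0 : 'rV[R]_n), sqn y < r.
    apply: (cvgr_lt (sqn (0 : 'rV[R]_n)) (continuous_sqn (x := 0))).
    by rewrite sqn0 expR_gt0.
  apply: filterS => y yr; rewrite ger0_norm ?sol_ge0// /sol.
  case: ifPn => // y0; have s0 : 0 < sqn y by rewrite sqn_gt0.
  have : ln (sqn y) < 2 * (1 - expR (- eps^-1 * ln d)).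
    by rewrite -[ltRHS]expRK ltr_ln ?posrE ?expR_gt0.
  move=> lnr; have Lr : expR (- eps^-1 * ln d) < logr y by rewrite /logr; lra.
  rewrite -[ltRHS]lnK ?posrE// ltr_expR.
  have : - eps^-1 * ln d < ln (logr y).
    rewrite -[ltLHS]expRK ltr_ln ?posrE ?expR_gt0//.
    exact: lt_trans (expR_gt0 _) Lr.
  by rewrite -(ltr_pM2l e0) mulNr mulrN mulVKf ?gt_eqF//; lra.
have s0 : 0 < sqn x by rewrite sqn_gt0.
have L0 := logr_gt0 x1.
(* Off the origin the solution is locally a function of s, continuous because s > 0 and L > 0. *)
pose g (s : R) := expR (- eps * ln (1 - ln s / 2)).
have cg : {for sqn x, continuous g}.
  apply: (@continuous_comp _ _ _ (fun s => - eps * ln (1 - ln s / 2)) expR);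
    last exact: continuous_expR.
  apply: cvgM; first exact: cvg_cst.
  apply: (@continuous_comp _ _ _ (fun s => 1 - ln s / 2) (@ln R));
    last exact: continuous_ln.
  apply: cvgB; first exact: cvg_cst.
  by apply: cvgM; [exact: continuous_ln|exact: cvg_cst].
have c : {for x, continuous (g \o sqn)}.
  by apply: continuous_comp; [exact: continuous_sqn|exact: cg].
have solx : sol eps x = (g \o sqn) x by rewrite /sol (negbTE x0).
rewrite /prop_for /continuous_at solx.
have near_sol : {near x, g \o sqn =1 sol eps}.
  apply: filterS (cvgr_gt (sqn x) (continuous_sqn (x := x)) _ s0) => y.
  by rewrite sqn_gt0 /sol => /negbTE ->.
exact: (cvg_trans (near_eq_cvg near_sol) c).
Qed.

End boundary_values.

(** * The weak gradient and the weak equation *)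

Section weak_formulation.
Context {R : realType} {m : nat} (hm : (2 <= m)%N) (eps : R) (e0 : 0 < eps).
Local Notation leb := (lebesgue_rV R m.+1).
Local Notation ball := (unit_ball R m.+1).
Variable phi : 'rV[R]_m.+1 -> R.
Hypothesis phiP : test_function ball phi.

Lemma sol_ins_rV i (y : 'rV[R]_m) : 0 < sqn y ->
  (fun t : R => sol eps (ins_rV i (t, y))) =
  (fun t => expR (- eps * ln (1 - ln (t ^+ 2 + sqn y) / 2))).
Proof.
move=> y0; apply/funext => t; rewrite /sol -sqn_eq0 /logr sqn_ins_rV.
by rewrite gt_eqF// ltr_wpDl// sqr_ge0.
Qed.

Lemma grad_ins_rV i (y : 'rV[R]_m) : 0 < sqn y ->
  (fun t : R => grad eps i (ins_rV i (t, y))) =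
  (fun t => eps * expR (- eps * ln (1 - ln (t ^+ 2 + sqn y) / 2)) * t *
     ((t ^+ 2 + sqn y) * (1 - ln (t ^+ 2 + sqn y) / 2))^-1).
Proof.
move=> y0; apply/funext => t; have := congr1 (@^~ t) (sol_ins_rV i y0) => /= h.
by rewrite /grad h ins_rV_eq /hardy /logr sqn_ins_rV.
Qed.

Lemma grad2_ins_rV i (y : 'rV[R]_m) : 0 < sqn y ->
  (fun t : R => grad2 eps i (ins_rV i (t, y))) = line_second eps (sqn y).
Proof.
move=> y0; apply/funext => t; have := congr1 (@^~ t) (sol_ins_rV i y0) => /= h.
by rewrite /grad2 h ins_rV_eq /hardy /logr sqn_ins_rV.
Qed.

Lemma weak_derivative_sol i :
  [/\ leb.-integrable ball (EFin \o (fun x => sol eps x * partial i phi x)),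
      leb.-integrable ball (EFin \o (fun x => grad eps i x * phi x)) &
    \int[leb]_(x in ball) (sol eps x * partial i phi x) =
    - \int[leb]_(x in ball) (grad eps i x * phi x)].
Proof.
apply: (integration_by_parts_off_origin hm (K := 1 + eps * (eps + 3))) => //.
- exact: measurable_sol.
- exact: measurable_grad.
- by move=> x; exact: sol_bound.
- by move=> x Bx; exact: grad_bound.
- move=> y t y01 t1; have /andP[y0 _] := y01; rewrite sol_ins_rV//.
  have := congr1 (@^~ t) (grad_ins_rV i y0) => /= ->.
  exact: is_derive_profile.
- move=> y t y01 t1; have /andP[y0 _] := y01; rewrite grad_ins_rV//.
  exact: (@continuous_is_derive _ _ (line_second eps (sqn y)))
    (is_derive_profile2 eps y01 t1).
Qed.

Lemma weak_derivative_grad i :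
  [/\ leb.-integrable ball (EFin \o (fun x => grad eps i x * partial i phi x)),
      leb.-integrable ball (EFin \o (fun x => grad2 eps i x * phi x)) &
    \int[leb]_(x in ball) (grad eps i x * partial i phi x) =
    - \int[leb]_(x in ball) (grad2 eps i x * phi x)].
Proof.
apply: (integration_by_parts_off_origin hm (K := 1 + eps * (eps + 3))) => //.
- exact: measurable_grad.
- exact: measurable_grad2.
- by move=> x Bx; exact: grad_bound.
- by move=> x Bx; exact: grad2_bound.
- move=> y t y01 t1; have /andP[y0 _] := y01; rewrite grad_ins_rV//.
  have := congr1 (@^~ t) (grad2_ins_rV i y0) => /= ->.
  exact: is_derive_profile2.
- move=> y t y01 t1; have /andP[y0 _] := y01; rewrite grad2_ins_rV//.
  exact: continuous_profile2.
Qed.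

Lemma Rintegral_sum_ord k (f : 'I_k -> 'rV[R]_m.+1 -> R) :
  (forall i, leb.-integrable ball (EFin \o f i)) ->
  \int[leb]_(x in ball) (\sum_(i < k) f i x) =
  \sum_(i < k) \int[leb]_(x in ball) f i x.
Proof.
have mB := @measurable_unit_ball R m.+1.
elim: k f => [|k IHk] f fi.
  rewrite big_ord0; under eq_Rintegral do rewrite big_ord0.
  by rewrite /Rintegral integral0.
rewrite big_ord_recl -IHk//; under eq_Rintegral do rewrite big_ord_recl.
rewrite RintegralD//.
rewrite (_ : _ \o _ = fun x => (\sum_(i < k) (f (lift ord0 i) x)%:E)%E).
  by apply: integrable_sum => // i _; exact: fi.
by apply/funext => x /=; rewrite sumEFin.
Qed.

(** Integrating each [grad] term by parts once more moves the derivative off [phi]; the sum of the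
    [grad2] terms then cancels the potential term pointwise in the ball. *)
Lemma weak_equation_sol :
  \int[leb]_(x in ball) (\sum_(i < m.+1) grad eps i x * partial i phi x) +
  \int[leb]_(x in ball) (potential eps x * sol eps x * phi x) = 0.
Proof.
rewrite Rintegral_sum_ord; last by move=> i; have [] := weak_derivative_grad i.
rewrite (eq_bigr (fun i => - \int[leb]_(x in ball) (grad2 eps i x * phi x))).
  rewrite sumrN -Rintegral_sum_ord; last first.
    by move=> i; have [] := weak_derivative_grad i.
  apply/eqP; rewrite addrC subr_eq0; apply/eqP; apply: eq_Rintegral => x.
  rewrite inE unit_ballE => /ltW x1.
  by rewrite -sum_grad2// mulr_suml.
by move=> i _; have [] := weak_derivative_grad i.
Qed.

End weak_formulation.

(** * The norm of the potential as eps tends to 0 *)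

Section potential_norm.
Context {R : realType} {n : nat} (hn : (3 <= n)%N).
Local Notation leb := (lebesgue_rV R n).
Local Notation ball := (unit_ball R n).
Local Notation p := (n%:R / 2 : R).

Let p0 : 0 < p.
Proof. by rewrite divr_gt0// ltr0n (leq_trans _ hn). Qed.

(** The constant in the pointwise bound of the potential by [hardy]. *)
Let amp (eps : R) : R := eps * (n%:R - 1 + eps).

Let amp_ge0 eps : 0 < eps -> 0 <= amp eps.
Proof.
move=> e0; rewrite mulr_ge0 ?(ltW e0)// addr_ge0 ?(ltW e0)//.
by rewrite subr_ge0 ler1n (leq_trans _ hn).
Qed.

Lemma powR_potential_le eps x : 0 < eps -> ball x ->
  `|potential eps x| `^ p <= amp eps `^ p * hardy x `^ p.
Proof.
move=> e0 Bx; have h0 : 0 <= hardy x.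
  by apply: hardy_ge0; move: Bx; rewrite unit_ballE => /ltW.
rewrite ger0_norm; last by apply: potential_ge0 => //; exact: leq_trans hn.
rewrite -powRM ?amp_ge0// ge0_ler_powR ?(ltW p0) ?nnegrE//.
- by apply: potential_ge0 => //; exact: leq_trans hn.
- by rewrite mulr_ge0 ?amp_ge0.
- exact: potential_le.
Qed.

Let measurable_powR_potential eps :
  measurable_fun setT (fun x : 'rV[R]_n => `|potential eps x| `^ p).
Proof.
apply: (measurableT_comp (@measurable_powR R p)).
apply: (measurableT_comp (@normr_measurable R setT)).
exact: measurable_potential.
Qed.

Lemma integrable_powR_potential eps : 0 < eps ->
  leb.-integrable ball (EFin \o (fun x => `|potential eps x| `^ p)).
Proof.
move=> e0; have mB := @measurable_unit_ball R n.
apply: (le_integrable mB _ _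
  (integrableZl mB (amp eps `^ p) (integrable_powR_hardy hn))).
  by apply/measurable_EFinP/measurable_funTS; exact: measurable_powR_potential.
move=> x Bx /=; rewrite lee_fin ger0_norm ?powR_ge0//.
by rewrite (le_trans (powR_potential_le e0 Bx))// ler_norm.
Qed.

Let I : R := \int[leb]_(x in ball) (hardy x `^ p).

(** The factor I^(1/p) is the L^p norm of [hardy], finite and independent of eps. *)
Lemma Lp_norm_potential_le eps : 0 < eps ->
  (Lp_norm ball p (potential eps) <= (amp eps * I `^ p^-1)%:E)%E.
Proof.
move=> e0; have mB := @measurable_unit_ball R n.
have ih := integrable_powR_hardy (R := R) hn.
have I0 : 0 <= I by apply: Rintegral_ge0 => x _; exact: powR_ge0.
have IE : (\int[leb]_(x in ball) (hardy x `^ p)%:E = I%:E)%E.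
  by rewrite /I /Rintegral fineK//; exact: integrable_fin_num.
rewrite Lp_normE//.
have -> : (amp eps * I `^ p^-1)%:E = ((amp eps `^ p * I)%:E `^ p^-1)%E.
  rewrite poweR_EFin powRM ?powR_ge0// -powRrM mulfV ?gt_eqF//.
  by rewrite powRr1// amp_ge0.
apply: gt0_ler_poweR; rewrite ?invr_ge0 ?(ltW p0)//.
- rewrite in_itv /= leey andbT; apply: integral_ge0 => x _.
  by rewrite lee_fin powR_ge0.
- by rewrite in_itv /= leey andbT lee_fin mulr_ge0// powR_ge0.
rewrite EFinM -IE -integralZl//.
apply: ge0_le_integral => //.
- by apply/measurable_EFinP/measurable_funTS; exact: measurable_powR_potential.
- by case/integrableP: (integrableZl mB (amp eps `^ p) ih).
- by move=> x Bx; rewrite -EFinM lee_fin; exact: powR_potential_le.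
Qed.

Lemma cvg_Lp_norm_potential :
  Lp_norm ball p (potential eps) @[eps --> 0^'+] --> 0%E.
Proof.
apply: (@squeeze_cvge _ _ _ _ (fun=> 0%E) _ (fun eps => (amp eps * I `^ p^-1)%:E)).
- near=> eps; apply/andP; split; first exact: Lnorm_ge0.
  by apply: Lp_norm_potential_le; near: eps; exact: nbhs_right_gt.
- exact: cvg_cst.
- apply: cvg_EFin; first exact: nearW.
  apply: cvg_at_right_filter.
  (* The upper bound is a polynomial in eps vanishing at 0, so its one-sided limit is its value
     there. *)
  have : {for (0 : R), continuous (fun eps => amp eps * I `^ p^-1)}.
    apply: cvgM; last exact: cvg_cst.
    apply: cvgM; first exact: cvg_id.
    by apply: cvgD; [exact: cvg_cst|exact: cvg_id].
  by rewrite /prop_for /continuous_at /amp !mul0r.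
Unshelve. all: by end_near. Qed.

End potential_norm.

Theorem theorem1p1 (R : realType) (n : nat) (hn : (3 <= n)%N) :
  exists c u : R -> 'rV[R]_n -> R,
    (forall eps : R, 0 < eps ->
      [/\ in_Lp (unit_ball R n) (n%:R / 2) (c eps),
          in_H1 (unit_ball R n) (u eps),
          {within closure (unit_ball R n), continuous (u eps)} &
          weak_solution (unit_ball R n) (c eps) (u eps)] /\
      (forall x, boundary (unit_ball R n) x -> 1 <= u eps x) /\
      u eps 0 = 0) /\
    Lp_norm (unit_ball R n) (n%:R / 2) (c eps) @[eps --> 0^'+] --> 0%E.
Proof.
exists potential, sol; split; last exact: cvg_Lp_norm_potential.
move=> eps e0; split; last first.
  by split=> [x|]; [exact: sol_boundary|exact: sol0].
have gradP : L2_weak_gradient (unit_ball R n) (sol eps) (grad eps).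
  split=> [i|i phi phiP].
    apply: (in_L2_unit_ball (K := eps ^+ 2) hn (measurable_grad eps i)) => x Bx.
    exact: sqr_grad_bound.
  (* Integration by parts is stated in dimension m + 1, where 3 <= m + 1 unfolds to 2 <= m. *)
  case: n hn i phi phiP => // m hm i phi phiP.
  by have [] := weak_derivative_sol hm e0 phiP i.
split.
- apply: in_Lp_unit_ball; last exact: integrable_powR_potential.
    by rewrite divr_gt0// ltr0n (leq_trans _ hn).
  exact: measurable_potential.
- split; last by exists (grad eps).
  (* Since 0 <= u <= 1, the square of u is at most u, and the bound on u suffices. *)
  apply: (in_L2_unit_ball (K := 1 + eps * (eps + 3)) hn (measurable_sol eps)).
  move=> x Bx; apply: le_trans (sol_bound e0 Bx).
  rewrite ger0_norm ?sol_ge0// expr2 ler_piMl ?sol_ge0// sol_le1//.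
  by move: Bx; rewrite unit_ballE => /ltW.
- apply: continuous_in_subspaceT => x /[!inE] /closure_unit_ball.
  exact: continuous_sol.
- exists (grad eps) => // phi phiP.
  by case: n hn phi phiP {gradP} => // m hm phi phiP; exact: weak_equation_sol.
Qed.
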